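(* Consider a stochastic shortest path problem (undiscounted, $\alpha=1$) with finite state set $S=\{1,\dots,n\}$ and finite action set $A$, in which all policies are proper. Let the stepsizes satisfy $\sum_{t=0}^\infty\gamma_t=\infty$ and $\sum_{t=0}^\infty\gamma_t^2<\infty$. Let $\{J_t\}_{t\ge 0}\subset\mathbb{R}^n$ be generated by the optimistic policy iteration $$J_{t+1}=(1-\gamma_t)J_t+\gamma_t\,(J^{\mu_t}+w_t),\qquad T_{\mu_t}J_t=TJ_t .$$ Then $J_t$ converges to $J^*$ with probability 1.
   Context: Stochastic shortest path problem: $S=\{1,\dots,n\}$ is a finite state set, $A$ a finite action set, and $0$ is an additional terminal state. For each action $a\in A$ there are transition probabilities $P_{ij}(a)\ge 0$ ($i,j\in S$) with $\sum_{j=1}^nP_{ij}(a)\le 1$ and $P_{i0}(a)=1-\sum_{j=1}^nP_{ij}(a)$; the terminal state is absorbing ($P_{00}(a)=1$) and cost free ($g(0,a)=0$). $g:S\times A\to\mathbb{R}$ is the stage cost. A policy is a function $\mu:S\to A$; $\Pi$ is the (finite) set of policies. The cost-to-go of $\mu$ is $J^\mu(i)=\mathbb{E}\left[\sum_{t=0}^\infty g(s_t,\mu(s_t))\mid s_0=i\right]$, $i\in S$, where $s_t$ evolves under $\mu$; the optimal value is $J^*(i)=\min_{\mu\in\Pi}J^\mu(i)$. A policy is proper if the terminal state is reached with probability 1 from any initial state. Write $P_\mu=(P_{ij}(\mu(i)))_{i,j\in S}$ and $g_\mu=(g(i,\mu(i)))_{i\in S}$. For $J\in\mathbb{R}^n$: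 $T_\mu J=g_\mu+P_\mu J$ and $TJ(i)=\min_{a\in A}\left[g(i,a)+\sum_{j=1}^nP_{ij}(a)J(j)\right]$. A policy $\mu$ with $T_\mu J=TJ$ is called greedy for $J$; thus $\mu_t$ is a greedy policy for $J_t$. Stepsizes $\gamma_t$ are deterministic nonnegative scalars. $w_t\in\mathbb{R}^n$ is the random noise (the difference between the observed cumulative cost of simulated trajectories under $\mu_t$, one from each initial state, and its expectation $J^{\mu_t}$). With $\mathcal{F}_t$ the natural filtration of the process (so $J_t,\mu_t$ are $\mathcal{F}_t$-measurable), the noise satisfies $\mathbb{E}[w_t\mid\mathcal{F}_t]=0$ and $\mathbb{E}[\|w_t\|^2\mid\mathcal{F}_t]\le C$ for some constant $C$ and all $t$. *)

(* Defs.v *)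
From HB Require Import structures.
From mathcomp Require Import all_boot all_order all_algebra.
From mathcomp Require Import all_classical all_reals all_analysis.

Set Implicit Arguments.
Unset Strict Implicit.
Unset Printing Implicit Defensive.

Import Order.TTheory GRing.Theory Num.Theory.
Import numFieldNormedType.Exports.

Local Open Scope classical_set_scope.
Local Open Scope ring_scope.

(* The non-terminal states are 'I_n; [tprob a i j] is P_ij(a). The missing mass
   of row i is the probability of moving to the terminal state. *)
Record ssp (R : realType) (n : nat) (A : finType) := SSP {
  tprob : A -> 'M[R]_n;
  cost : 'I_n -> A -> R;
  tprob_ge0 : forall a i j, 0 <= tprob a i j;
  tprob_sum_le1 : forall a i, \sum_(j < n) tprob a i j <= 1
}.

Definition policy (n : nat) (A : finType) := {ffun 'I_n -> A}.

(* The minimum of F over a finite type; the witness x0 only certifies that the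
   type is inhabited, the value does not depend on it. *)
Definition min_over (R : realType) (X : finType) (x0 : X) (F : X -> R) : R :=
  F [arg min_(x < x0) F x]%O.

Section Dynamics.
Variables (R : realType) (n : nat) (A : finType) (M : ssp R n A).

Definition P_of (mu : policy n A) : 'M[R]_n := \matrix_(i, j) tprob M (mu i) i j.

Definition g_of (mu : policy n A) : 'cV[R]_n := \col_i cost M i (mu i).

Definition bellman_mu (mu : policy n A) (J : 'cV[R]_n) : 'cV[R]_n :=
  g_of mu + P_of mu *m J.

Definition bellman (a0 : A) (J : 'cV[R]_n) : 'cV[R]_n :=
  \col_i min_over a0
    (fun a => cost M i a + \sum_(j < n) tprob M a i j * J j ord0).

Definition greedy (a0 : A) (mu : policy n A) (J : 'cV[R]_n) : Prop :=
  bellman_mu mu J = bellman a0 J.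

(* On the full state space [option 'I_n], [None] is the absorbing and cost-free
   terminal state. *)
Definition step_prob (mu : policy n A) (x y : option 'I_n) : R :=
  match x, y with
  | Some i, Some j => tprob M (mu i) i j
  | Some i, None => 1 - \sum_(j < n) tprob M (mu i) i j
  | None, None => 1
  | None, Some _ => 0
  end.

Definition stage_cost (mu : policy n A) (x : option 'I_n) : R :=
  if x is Some i then cost M i (mu i) else 0.

Section Chain.
Context (d : measure_display) (Tr : measurableType d).
Variables (Q : probability Tr R) (s : nat -> Tr -> option 'I_n).

(* Under Q, s is the Markov chain started at i and driven by mu. The
   Markov property is multiplied out, so that histories of probability zero
   need no special treatment. *)
Definition markov_chain (mu : policy n A) (i : 'I_n) : Prop :=
  [/\ forall t x, measurable [set tau | s t tau = x],
      Q [set tau | s 0%N tau = Some i] = 1%E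
    & forall t (x : nat -> option 'I_n),
        Q [set tau | forall k, (k <= t.+1)%N -> s k tau = x k] =
        (Q [set tau | forall k, (k <= t)%N -> s k tau = x k] *
         (step_prob mu (x t) (x t.+1))%:E)%E].

Definition total_cost (mu : policy n A) (tau : Tr) : R :=
  limn (series (fun t => stage_cost mu (s t tau))).

End Chain.

(* [Q mu i] is the law of the state process
   s under mu from the initial state i. *)
Section CostToGo.
Context (d : measure_display) (Tr : measurableType d).
Variables (Q : policy n A -> 'I_n -> probability Tr R)
  (s : nat -> Tr -> option 'I_n).

Definition proper_policy (mu : policy n A) : Prop :=
  forall i, Q mu i [set tau | exists t, s t tau = None] = 1%E.

Definition cost_to_go (mu : policy n A) : 'cV[R]_n :=
  \col_i fine ('E_(Q mu i)[total_cost s mu])%E.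

Definition opt_cost (a0 : A) : 'cV[R]_n :=
  \col_i min_over ([ffun=> a0] : policy n A) (fun mu => cost_to_go mu i ord0).

End CostToGo.
End Dynamics.

Section Conditioning.
Context (d : measure_display) (Omega : measurableType d) (R : realType).
Variable P : probability Omega R.

(* Y is a version of the conditional expectation of X given the sub-sigma-algebra
   whose measurable sets are F. *)
Definition is_condexp (F : set (set Omega)) (X Y : Omega -> R) : Prop :=
  [/\ P.-integrable setT (EFin \o X),
      P.-integrable setT (EFin \o Y),
      forall B : set R, measurable B -> F (Y @^-1` B)
    & forall E, F E ->
        (\int[P]_(om in E) (X om)%:E = \int[P]_(om in E) (Y om)%:E)%E].

(* The sigma-algebra generated by J_0, mu_0, ..., J_t, mu_t. *)
Definition natural_filtration (n : nat) (A : finType)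
    (J : nat -> Omega -> 'cV[R]_n) (mu : nat -> Omega -> policy n A)
    (t : nat) : set (set Omega) :=
  <<s [set E | exists2 k, (k <= t)%N &
        (exists i, exists2 B : set R, measurable B &
           E = [set om | B (J k om i ord0)]) \/
        (exists m : policy n A, E = [set om | mu k om = m])] >>.

End Conditioning.

(* Main.v *)
Require Import Defs.
From HB Require Import structures.
From mathcomp Require Import all_boot all_order all_algebra.
From mathcomp Require Import all_classical all_reals all_analysis.
From mathcomp Require Import measurable_realfun ring lra.

Set Implicit Arguments.
Unset Strict Implicit.
Unset Printing Implicit Defensive.

Import Order.TTheory GRing.Theory Num.Theory.
Import numFieldNormedType.Exports.

Local Open Scope classical_set_scope.
Local Open Scope ring_scope.

(** Let T be the Bellman operator, and for a policy m let T_m J = g_m + P_m J,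
    with fixed point J^m. The argument separates what holds on every path with
    summable noise from the fact that almost every path has summable noise.

    Pathwise part. Assume that, for every policy m and every coordinate, the
    series of the terms gamma_t w_t over the times t at which mu_t = m
    converges. Greediness gives T J_(t+1) <= T_(mu_t) J_(t+1); as T_(mu_t) is
    affine, fixes J^(mu_t) and agrees with T at J_t, the residual
    X_t = T J_t - J_t satisfies
      X_(t+1) <= (1 - gamma_t) X_t + gamma_t (P_(mu_t) - I) w_t,
    hence limsup X_t <= 0 ([bellman_residual_limsup]). A residual of at most e
    can be collected at most once per visit to a nonterminal state, so
    J^(mu_t) <= T J_t + e xi, where xi bounds the expected absorption times
    ([residual_bound]). Now compare with any fixed policy m: T J_t <= T_m J_t
    turns the recursion for U_t = J_t - J^m into
      U_(t+1) <= (1 - gamma_t) U_t + gamma_t (P_m U_t + O(e) + w_t),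
    and P_m shrinks vectors in the norm weighted by the absorption times of m,
    so limsup J_t <= J^m ([drift_limsup], [limsup_le_policy]). This holds for
    every m, hence limsup J_t is at most the minimum J^*. In the other
    direction J^(mu_t) >= J^* makes J_t at least an average of J^* and noise
    ([liminf_ge_lower_bound]).

    Probabilistic part. Conditioning on mu_t = m keeps the terms gamma_t w_t
    martingale differences, with summable variances gamma_t^2 C, so their
    series converge almost surely ([martingale_series_cvg]). This is proved
    from Kolmogorov's maximal inequality for a stopped sum, whose increments
    are orthogonal to its past ([integral_adapted_mul]).

    Link with the Markov chain. Properness says that the powers of P_m tend
    to 0, so I - P_m is invertible; dominated convergence identifies the
    expected total cost with (I - P_m)^-1 g_m ([expected_total_cost]), which
    yields both the equation T_m J^m = J^m and the weights
    xi = (I - P_m)^-1 1. *)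

(** * Stochastic approximation with a drift *)

(** An elementary substitute for bounding the product by the exponential of
    minus the sum: it tends to 0 as soon as the series diverges. *)
Lemma prod_one_sub_le (R : realFieldType) (x : nat -> R) (t : nat) :
  (forall k, 0 <= x k <= 1) ->
  0 <= \prod_(0 <= k < t) (1 - x k) /\
  (\prod_(0 <= k < t) (1 - x k)) * (1 + \sum_(0 <= k < t) x k) <= 1.
Proof.
move=> x01; elim: t => [|t [p0 p1]]; first by rewrite !big_nil; split; lra.
rewrite !big_nat_recr //=; have /andP[xt0 xt1] := x01 t.
split; first by apply: mulr_ge0 => //; lra.
have S0 : 0 <= \sum_(0 <= k < t) x k.
  by apply: sumr_ge0 => k _; case/andP: (x01 k).
apply: le_trans p1; rewrite -mulrA ler_wpM2l //; nra.
Qed.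

(** If D_t <= (e + C) xi with C >= 0, the condition p xi <= xi - 1 leaves a
    slack of gamma_t C in the next step, which is at least the fraction
    gamma_t / B of C xi when xi <= B. So the excess C over e decays like the product of the
    factors 1 - gamma_t / B. *)
Lemma drift_noiseless (R : realType) (I : finType) (p : I -> I -> R)
    (xi : I -> R) (gamma : nat -> R) (D : nat -> I -> R) (e : R) :
  (forall i j, 0 <= p i j) ->
  (forall i, 1 <= xi i) ->
  (forall i, \sum_j p i j * xi j <= xi i - 1) ->
  (forall t, 0 <= gamma t <= 1) ->
  series gamma @ \oo --> +oo ->
  0 <= e ->
  (forall t i, D t.+1 i <=
     (1 - gamma t) * D t i + gamma t * (\sum_j p i j * D t j + e)) ->
  forall delta, 0 < delta ->
  \forall t \near \oo, forall i, D t i <= (e + delta) * xi i.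
Proof.
move=> p0 xi1 pxi g01 gdiv e0 Drec delta d0.
pose B := 1 + \sum_i xi i.
have B1 : 1 <= B.
  by rewrite lerDl; apply: sumr_ge0 => i _; apply: le_trans (xi1 i).
have xiB i : xi i <= B.
  rewrite /B (bigD1 i) //= addrCA lerDl addr_ge0 //.
  by apply: sumr_ge0 => j _; apply: le_trans (xi1 j).
pose c := \sum_i `|D 0%N i|.
have c0 : 0 <= c by apply: sumr_ge0.
pose q t := \prod_(0 <= k < t) (1 - gamma k / B).
have gB01 k : 0 <= gamma k / B <= 1.
  have /andP[g0 g1] := g01 k; rewrite divr_ge0 //=; last lra.
  by rewrite ler_pdivrMr; lra.
have q0 t : 0 <= q t by have [] := prod_one_sub_le t gB01.
have Dle t i : D t i <= (e + c * q t) * xi i.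
  elim: t i => [|t IH] i.
    rewrite /q big_nil mulr1; apply: le_trans (ler_norm _) _.
    have Dc : `|D 0%N i| <= c by rewrite /c (bigD1 i) //= lerDl; apply: sumr_ge0.
    have := xi1 i; nra.
  have /andP[g0 g1] := g01 t.
  have s0 : 0 <= e + c * q t by rewrite addr_ge0 // mulr_ge0.
  set s := e + c * q t in IH s0.
  apply: le_trans (Drec t i) _.
  have PD : \sum_j p i j * D t j <= s * (xi i - 1).
    apply: le_trans (_ : s * \sum_j p i j * xi j <= _); last exact: ler_wpM2l.
    rewrite mulr_sumr ler_sum // => j _; rewrite mulrCA.
    exact: ler_wpM2l.
  have -> : q t.+1 = q t * (1 - gamma t / B) by rewrite /q big_nat_recr.
  apply: le_trans (_ : (1 - gamma t) * (s * xi i)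
     + gamma t * (s * (xi i - 1) + e) <= _).
    by rewrite lerD // ler_wpM2l // ?subr_ge0 // lerD.
  rewrite /s.
  have cq0 : 0 <= c * q t by rewrite mulr_ge0.
  have : c * (q t * (gamma t / B)) * xi i <= gamma t * (c * q t).
    have -> : c * (q t * (gamma t / B)) * xi i = gamma t * (c * q t) * (xi i / B).
      by field; lra.
    rewrite ler_piMr ?mulr_ge0 // ler_pdivrMr; last lra.
    by rewrite mul1r.
  lra.
move/cvgryPge : gdiv => /(_ (B * (c / delta))) [T _ HT].
exists T => // t /= Tt i; apply: le_trans (Dle t i) _.
rewrite ler_wpM2r //; first by apply: le_trans (xi1 i).
rewrite lerD2l.
have [_] := prod_one_sub_le t gB01; rewrite -mulr_suml -/(q t) => qle.
have := HT t Tt; rewrite /series /= => Sge.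
have : c / delta <= (\sum_(0 <= k < t) gamma k) / B.
  by rewrite ler_pdivlMr ?(mulrC _ B) //; lra.
set S := _ / B in qle *; rewrite ler_pdivrMr // => cS.
have : q t * c <= q t * (S * delta) by rewrite ler_wpM2l.
have := q0 t.
nra.
Qed.

(** Adding to U_t the tail r_t of the convergent noise series cancels w_t, as
    r_(t+1) = r_t - gamma_t w_t. The sum follows the noiseless recursion up to
    an error r_t - p r_t, and it has the same limsup as U_t since r_t tends
    to 0. With p = 0 and xi = 1 this is the scalar averaging lemma. *)
Lemma drift_limsup (R : realType) (I : finType) (p : I -> I -> R)
    (xi : I -> R) (gamma : nat -> R) (U w : nat -> I -> R) (e : R) :
  (forall i j, 0 <= p i j) ->
  (forall i, \sum_j p i j <= 1) ->
  (forall i, 1 <= xi i) ->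
  (forall i, \sum_j p i j * xi j <= xi i - 1) ->
  (forall t, 0 <= gamma t) ->
  gamma @ \oo --> 0 ->
  series gamma @ \oo --> +oo ->
  0 <= e ->
  (forall i, cvgn (series (fun t => gamma t * w t i))) ->
  (\forall t \near \oo, forall i, U t.+1 i <=
     (1 - gamma t) * U t i + gamma t * (\sum_j p i j * U t j + e + w t i)) ->
  forall delta, 0 < delta ->
  \forall t \near \oo, forall i, U t i <= (e + delta) * xi i.
Proof.
move=> p0 p1 xi1 pxi g0 gcvg gdiv e0 wcvg Urec delta d0.
pose eta := delta / 4.
have eta0 : 0 < eta by rewrite divr_gt0.
pose r t i := limn (series (fun t => gamma t * w t i))
              - series (fun t => gamma t * w t i) t.
have rS t i : r t.+1 i = r t i - gamma t * w t i.
  by rewrite /r /series /= big_nat_recr //=; lra.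
have rsmall : \forall t \near \oo, forall i, `|r t i| <= eta.
  apply: filter_forall => i.
  have /cvgr_dist_le/(_ eta eta0) := wcvg i.
  exact.
have gsmall : \forall t \near \oo, gamma t <= 1.
  have /cvgr_dist_le/(_ 1 ltr01) := gcvg.
  by apply: filterS => t; rewrite sub0r normrN ger0_norm.
have : \forall t \near \oo, [/\ forall i, `|r t i| <= eta, gamma t <= 1 &
   forall i, U t.+1 i <=
     (1 - gamma t) * U t i + gamma t * (\sum_j p i j * U t j + e + w t i)].
  by near=> t; split; near: t.
move=> [T _ HT].
pose g' t := gamma (T + t)%N.
pose D t i := U (T + t)%N i + r (T + t)%N i.
have g'div : series g' @ \oo --> +oo.
  apply/cvgryPge => a.
  move/cvgryPge : gdiv => /(_ (a + series gamma T)) [N _ HN].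
  exists N => // t /= Nt.
  have := HN (T + t)%N (leq_trans Nt (leq_addl _ _)).
  rewrite /series /= [X in _ <= X -> _](@big_cat_nat _ _ _ T) ?leq_addr //=.
  rewrite [X in X <= _ -> _]addrC lerD2l.
  rewrite -[X in \sum_(X <= _ < _) _]add0n big_addn addKn.
  by under eq_bigr do rewrite addnC.
have core := @drift_noiseless R I p xi g' D (e + 2 * eta) p0 xi1 pxi _ g'div
  _ _ eta eta0.
have : \forall t \near \oo, forall i, D t i <= (e + 2 * eta + eta) * xi i.
  apply: core.
  - move=> t; rewrite /g' g0 /=.
    by have [] := HT (T + t)%N (leq_addr _ _).
  - by rewrite addr_ge0 // mulr_ge0 // ltW.
  - move=> t i; rewrite /D addnS.
    have [rt gt1 Ut] := HT (T + t)%N (leq_addr _ _).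
    rewrite rS; have := Ut i.
    under [in X in _ -> X]eq_bigr do rewrite mulrDr.
    rewrite big_split /=.
    set a := U _ i; set rr := r _ i; set S := \sum_j _ * U _ _.
    set Q := \sum_j _ * r _ _.
    have rQ : rr - Q <= 2 * eta.
      have : `|Q| <= eta.
        apply: le_trans (ler_norm_sum _ _ _) _.
        apply: le_trans (_ : \sum_j p i j * eta <= _).
          by apply: ler_sum => j _; rewrite normrM ger0_norm // ler_wpM2l.
        by rewrite -mulr_suml ler_piMl // ltW.
      have := rt i; rewrite !ler_norml -/rr => /andP[_ ?] /andP[? _]; lra.
    have : gamma (T + t)%N * (rr - Q) <= gamma (T + t)%N * (2 * eta).
      by rewrite ler_wpM2l.
    rewrite /g'; lra.
move=> [T' _ HT'].
exists (T + T')%N => // t /= TTt i.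
have Tt : (T <= t)%N by apply: leq_trans TTt; exact: leq_addr.
have := HT' (t - T)%N; rewrite /= leq_subRL // => /(_ TTt i).
rewrite /D subnKC //.
have [/(_ i) + _ _] := HT t Tt.
rewrite ler_norml => /andP[? ?] h.
have := xi1 i; have : delta = 4 * eta by rewrite /eta; field.
nra.
Unshelve. all: by end_near.
Qed.

(** * Measurability of limits and finite partitions *)

(** The Cauchy criterion with countably many quantifiers, so that it can be
    read as a countable combination of events. *)
Lemma cvgn_cauchyP (R : realType) (S : nat -> R) :
  cvgn S <-> forall p : nat, exists m, forall j,
    `|S (m + j)%N - S m| <= p.+1%:R^-1.
Proof.
split=> [Scvg p|H].
  have : 0 < p.+1%:R^-1 :> R by rewrite invr_gt0.
  move: (p.+1%:R^-1) => e e0; have p0 : 0 < e / 2 by rewrite divr_gt0.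
  have /cvgr_dist_le/(_ _ p0)[m _ Hm] := Scvg.
  exists m => j; set l := limn S in Hm.
  have := Hm (m + j)%N (leq_addr _ _); have := Hm m (leqnn m) => /=.
  rewrite !ler_norml => /andP[? ?] /andP[? ?]; apply/andP; split; lra.
apply: cauchy_cvg; apply/cauchy_ballP => e e0.
have [p pe] : exists p : nat, p.+1%:R^-1 < e / 2.
  have e20 : 0 < e / 2 by rewrite divr_gt0.
  have /cvgr_lt/(_ _ e20)[p _ Hp] := @cvg_harmonic R.
  by exists p; exact: (Hp p (leqnn p)).
have [m Hm] := H p.
exists (S @` [set k | (m <= k)%N], S @` [set k | (m <= k)%N]) => /=.
  by split; exists m => // k /= mk; exists k.
move=> [_ _] /= [[j /= mj <-] [k /= mk <-]].
rewrite /ball /=.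
have := Hm (j - m)%N; have := Hm (k - m)%N; rewrite !subnKC //.
move: (p.+1%:R^-1) pe => q pe.
rewrite !ler_norml ltr_norml => /andP[? ?] /andP[? ?]; apply/andP; split; lra.
Qed.

Lemma measurable_cvgn d (T : measurableType d) (R : realType)
    (S : nat -> T -> R) :
  (forall k, measurable_fun setT (S k)) ->
  measurable [set x | cvgn (S ^~ x)].
Proof.
move=> mS.
have -> : [set x | cvgn (S ^~ x)] = \bigcap_(p in [set: nat]) \bigcup_m
    \bigcap_(j in [set: nat])
      [set x | `|S (m + j)%N x - S m x| <= p.+1%:R^-1].
  apply/seteqP; split=> x /=.
    by move/cvgn_cauchyP => H p _; have [m Hm] := H p; exists m => // j _; exact: Hm.
  move=> H; apply/cvgn_cauchyP => p; have [m _ Hm] := H p Logic.I.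
  by exists m => j; exact: Hm.
apply: bigcap_measurableType => p _; apply: bigcup_measurable => m _.
apply: bigcap_measurableType => j _.
rewrite -[X in measurable X]setTI.
apply: (@measurable_fun_le _ _ _ _ _ (cst _)) => //.
apply: measurableT_comp => //; exact: measurable_funB.
Qed.

(** Where the sequence diverges, [limn] takes the default value 0; hence it is
    everywhere the limit of the sequence cut off outside the convergence set. *)
Lemma measurable_fun_limn d (T : measurableType d) (R : realType)
    (S : nat -> T -> R) :
  (forall k, measurable_fun setT (S k)) ->
  measurable_fun setT (fun x => limn (S ^~ x)).
Proof.
move=> mS; have mD := measurable_cvgn mS; set D := [set x | _] in mD.
apply: (@measurable_fun_cvg _ _ _ _ (fun k => \1_D \* S k)) => [k|x _].
  by apply: measurable_funM => //; exact: measurable_indic.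
have [Dx|Dx] := pselect (D x).
  have -> : (fun k => (\1_D \* S k) x) = S ^~ x.
    by apply/funext => k /=; rewrite indicE mem_set // mul1r.
  exact: Dx.
have -> : (fun k => (\1_D \* S k) x) = cst 0.
  by apply/funext => k /=; rewrite indicE memNset // mul0r.
suff -> : limn (S ^~ x) = 0 by exact: cvg_cst.
by rewrite dvgP.
Qed.

Lemma measure_fin_partition d (T : measurableType d) (R : realType)
    (mu : {measure set T -> \bar R}) (X : finType) (h : T -> X) (E : set T) :
  (forall x, measurable [set t | h t = x]) -> measurable E ->
  mu E = (\sum_(x : X) mu (E `&` [set t | h t = x]))%E.
Proof.
move=> mh mE; pose F x := E `&` [set t | h t = x].
have mF x : measurable (F x) by exact: measurableI.
have EF : E = \big[setU/set0]_(x <- index_enum X) F x.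
  apply/seteqP; split => t.
    by move=> Et; rewrite -bigcup_seq; exists (h t) => //=; exact: mem_index_enum.
  by rewrite -bigcup_seq => -[x _ []].
rewrite -(mul1e (mu E)) -integral_cst // {1}EF ge0_integral_bigsetU //.
- by apply: eq_bigr => x _; rewrite integral_cst // mul1e.
- exact: index_enum_uniq.
- by move=> x y _ _ [t [[_ /= <-] [_ /= <-]]].
Qed.

(** * Matrices whose powers vanish *)

Lemma cvg_lincomb0 (R : realType) (I : finType) (c : I -> R)
    (u : I -> nat -> R) :
  (forall i, u i @ \oo --> 0) ->
  (fun t => \sum_i c i * u i t) @ \oo --> 0.
Proof.
move=> u0.
have c0 : \sum_i c i * 0 = 0 by rewrite big1 // => i _; rewrite mulr0.
rewrite -[X in _ --> X]c0.
apply: (@cvg_big _ _ +%R 0 xpredT (@add_continuous R)) => i _.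
by apply: cvgMl_tmp; exact: u0.
Qed.

Section transient_matrix.
Variables (R : realType) (n : nat) (P : 'M[R]_n).
Hypothesis P_transient : forall i j, (P ^+ t) i j @[t --> \oo] --> 0.

Lemma mulmx_pow_cvg0 m (c : 'M[R]_(n, m)) i k :
  (P ^+ t *m c) i k @[t --> \oo] --> 0.
Proof.
rewrite (_ : (fun t => _) = fun t => \sum_j c j k * (P ^+ t) i j); last first.
  by apply/funext => t; rewrite mxE; apply: eq_bigr => j _; rewrite mulrC.
by apply: cvg_lincomb0 => j; exact: P_transient.
Qed.

(** A row vector with K P = K satisfies K = K P^t for all t, which tends to
    0. *)
Lemma sub1_unitmx : 1%:M - P \in unitmx.
Proof.
rewrite -row_free_unit -kermx_eq0; apply/eqP.
have KP : kermx (1%:M - P) *m P = kermx (1%:M - P).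
  by apply/esym/eqP; rewrite -subr_eq0 -{1}[kermx _]mulmx1 -mulmxBr mulmx_ker.
move: (kermx _) KP => K KP.
have KPt t : K *m P ^+ t = K.
  elim: t => [|t IH]; first by rewrite expr0 mulmx1.
  by rewrite exprSr -mulmxE mulmxA IH KP.
apply/matrixP => i j; rewrite mxE.
suff K0 : cst (K i j) @ \oo --> 0.
  by rewrite -(cvg_lim (@Rhausdorff R) K0) lim_cst.
rewrite (_ : cst _ = fun t : nat => \sum_k K i k * (P ^+ t) k j); last first.
  by apply/funext => t; rewrite /= -{1}(KPt t) mxE.
by apply: cvg_lincomb0 => k; exact: P_transient.
Qed.

(** The sum of the powers of P, by [series_pow_cvg]: the (i, j) entry is the
    expected number of visits to j from i. *)
Definition potential : 'M[R]_n := invmx (1%:M - P).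

Lemma potentialE (c : 'cV[R]_n) : potential *m c = c + P *m (potential *m c).
Proof.
apply/eqP; rewrite -subr_eq -{1}[potential *m c]mul1mx -mulmxBl mulmxA.
by rewrite mulmxV ?sub1_unitmx // mul1mx.
Qed.

Lemma series_pow_cvg (c : 'cV[R]_n) i :
  series (fun t => (P ^+ t *m c) i ord0) @ \oo --> (potential *m c) i ord0.
Proof.
have SE t : \sum_(0 <= k < t) (P ^+ k *m c) = potential *m (c - P ^+ t *m c).
  rewrite -[LHS](mulKmx sub1_unitmx); congr (_ *m _).
  rewrite mulmx_sumr; elim: t => [|t IH]; first by rewrite big_nil expr0 mul1mx subrr.
  rewrite big_nat_recr //= IH mulmxBl mul1mx exprS -mulmxE mulmxA.
  by rewrite addrA subrK.
rewrite (_ : series _ = fun t =>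
  (potential *m c) i ord0 - \sum_j potential i j * (P ^+ t *m c) j ord0).
  rewrite -[X in _ --> X]subr0; apply: cvgB; first exact: cvg_cst.
  by apply: cvg_lincomb0 => k; exact: mulmx_pow_cvg0.
apply/funext => t; rewrite /series /=.
transitivity ((\sum_(0 <= k < t) (P ^+ k *m c)) i ord0); first by rewrite summxE.
by rewrite SE mulmxBr !mxE.
Qed.

End transient_matrix.

(** * The chain of a policy and its cost-to-go *)

Lemma sum_option (V : nmodType) (I : finType) (f : option I -> V) :
  \sum_a f a = f None + \sum_i f (Some i).
Proof.
rewrite (bigD1 None) //=; congr (_ + _).
rewrite (reindex_omap Some id) => [|[]//].
by apply: eq_bigl => i; rewrite eqxx.
Qed.

Section chain_law.
Variables (R : realType) (n : nat) (A : finType) (M : ssp R n A).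
Variables (d : measure_display) (Tr : measurableType d).
Variables (Q : probability Tr R) (s : nat -> Tr -> option 'I_n).
Variables (m : policy n A) (i : 'I_n).
Hypothesis s_chain : markov_chain M Q s m i.

Let s_meas t x : measurable [set tau | s t tau = x].
Proof. by case: s_chain. Qed.

#[local] Hint Resolve s_meas : core.

Let total_prob t E : measurable E ->
  Q E = (\sum_a Q (E `&` [set tau | s t tau = a]))%E.
Proof. exact: measure_fin_partition. Qed.

Let window_meas l t (x : nat -> option 'I_n) :
  measurable [set tau | forall k, (l <= k <= t)%N -> s k tau = x k].
Proof.
have -> : [set tau | forall k, (l <= k <= t)%N -> s k tau = x k] =
    \bigcap_(k in [set k | (l <= k <= t)%N]) [set tau | s k tau = x k].
  by apply/seteqP; split.
by apply: bigcap_measurableType => k _; exact: s_meas.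
Qed.

(** The Markov property is given for full histories. Histories that start at
    time l are obtained by summing over the state at time l - 1, one step at a
    time, so that only finite sums over states occur. *)
Lemma markov_window l t (x : nat -> option 'I_n) : (l <= t)%N ->
  Q [set tau | forall k, (l <= k <= t.+1)%N -> s k tau = x k] =
  (Q [set tau | forall k, (l <= k <= t)%N -> s k tau = x k] *
   (step_prob M m (x t) (x t.+1))%:E)%E.
Proof.
elim: l x => [|l IH] x lt; first by case: s_chain => _ _; apply.
pose upd z k := if k == l then z else x k.
have split_at (u : nat) z : (l <= u)%N ->
    [set tau | forall k, (l < k <= u)%N -> s k tau = x k]
      `&` [set tau | s l tau = z] =
    [set tau | forall k, (l <= k <= u)%N -> s k tau = upd z k].
  move=> lu; apply/seteqP; split=> tau /=.
    move=> [H zE] k /andP[lk ku]; rewrite /upd; case: eqP => [->//|/eqP nkl].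
    by apply: H; rewrite ku andbT ltn_neqAle eq_sym nkl lk.
  move=> H; split; last by rewrite H ?leqnn // /upd eqxx.
  move=> k /andP[lk ku]; rewrite H ?(ltnW lk) ?ku // /upd.
  by rewrite gtn_eqF.
rewrite (total_prob l) //.
rewrite [in RHS](total_prob l) //.
rewrite ge0_sume_distrl; last by move=> z _; exact: measure_ge0.
apply: eq_bigr => z _.
rewrite !split_at ?(ltnW lt) ?(leqW (ltnW lt)) // (IH (upd z)) ?(ltnW lt) //.
by rewrite /upd !gtn_eqF // ltnW.
Qed.

Lemma markov_step t a b :
  Q ([set tau | s t tau = a] `&` [set tau | s t.+1 tau = b]) =
  (Q [set tau | s t tau = a] * (step_prob M m a b)%:E)%E.
Proof.
pose x k := if k == t then a else b.
have := @markov_window t t x (leqnn t).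
rewrite /x eqxx gtn_eqF // => E.
transitivity (Q [set tau | forall k, (t <= k <= t.+1)%N ->
    s k tau = if k == t then a else b]).
  congr (Q _); apply/seteqP; split=> tau /=.
    move=> [sa sb] k /andP[tk kt]; case: eqP => [->//|/eqP nkt].
    suff -> : k = t.+1 by [].
    by apply/eqP; rewrite eqn_leq kt ltn_neqAle eq_sym nkt.
  move=> H; split; first by rewrite H ?leqnn ?leqnSn // eqxx.
  by rewrite H ?leqnn ?leqnSn // gtn_eqF.
rewrite E; congr (Q _ * _)%E; apply/seteqP; split=> tau /=.
  by move=> /(_ t); rewrite leqnn eqxx; apply.
by move=> sa k; rewrite -eqn_leq => /eqP <-; rewrite eqxx.
Qed.

Lemma chain_marginal t j :
  Q [set tau | s t tau = Some j] = ((P_of M m ^+ t) i j)%:E.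
Proof.
elim: t j => [|t IH] j.
  rewrite expr0 mxE; case: s_chain => _ Q0 _.
  have [<-//|nij] := eqVneq i j.
  apply: (@subset_measure0 _ _ _ _ _ (~` [set tau | s 0%N tau = Some i])) => //.
  - exact: measurableC.
  - by move=> tau /= -> [] /esym/eqP; rewrite (negbTE nij).
  - by apply: etrans (probability_setC Q (s_meas 0 _)) _; rewrite Q0 subee.
rewrite (total_prob t) //.
under eq_bigr do rewrite setIC markov_step.
rewrite sum_option /= mule0 add0e exprSr -mulmxE mxE -sumEFin.
by apply: eq_bigr => k _; rewrite IH mxE -EFinM.
Qed.

Let stage_meas t (c : option 'I_n -> R) :
  measurable_fun setT (fun tau => c (s t tau)).
Proof.
rewrite (_ : (fun _ => _) = fun tau =>
    \sum_a c a * \1_[set tau | s t tau = a] tau).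
  apply: measurable_sum => a; apply: measurable_funM => //.
apply/funext => tau; rewrite (bigD1 (s t tau)) //= indicE mem_set // mulr1.
rewrite big1 ?addr0 // => a nsa; rewrite indicE memNset ?mulr0 //= => /eqP.
by rewrite eq_sym (negbTE nsa).
Qed.

Lemma integral_stage t (c : option 'I_n -> R) : c None = 0 ->
  (\int[Q]_tau (c (s t tau))%:E)%E =
    ((P_of M m ^+ t *m \col_j c (Some j)) i ord0)%:E.
Proof.
move=> c0.
have cE tau : (c (s t tau))%:E =
    (\sum_j (c (Some j))%:E * (\1_[set tau | s t tau = Some j] tau)%:E)%E.
  case E : (s t tau) => [j|].
    rewrite (bigD1 j) //= indicE mem_set // mule1.
    rewrite big1 ?adde0 // => k nkj; rewrite indicE memNset ?mule0 //=.
    by rewrite E => -[] /eqP; rewrite eq_sym (negbTE nkj).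
  by rewrite c0 big1 // => k _; rewrite indicE memNset ?mule0 //= E.
under eq_integral do rewrite cE.
rewrite integral_sum //; last first.
  move=> j; apply: integrableZl => //.
  by apply: integrable_indic.
rewrite mxE -sumEFin; apply: eq_bigr => j _.
rewrite integralZl //; last exact: integrable_indic.
rewrite integral_indic // setIT.
transitivity ((c (Some j))%:E * ((P_of M m ^+ t) i j)%:E)%E.
  by congr (_ * _)%E; exact: chain_marginal.
by rewrite mxE -EFinM mulrC.
Qed.

(** The events F t that absorption has happened by time t increase to an event
    of probability 1. On F t the state at time t is terminal up to a null
    event, because the terminal state is left with probability 0. *)
Lemma marginal_cvg0 j :
  Q [set tau | exists t, s t tau = None] = 1%E ->
  (P_of M m ^+ t) i j @[t --> \oo] --> 0.
Proof.
move=> proper.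
pose F t := [set tau | exists2 k, (k <= t)%N & s k tau = None].
have mF t : measurable (F t).
  rewrite (_ : F t = \bigcup_(k in [set k | (k <= t)%N]) [set tau | s k tau = None]).
    exact: bigcup_measurable.
  by apply/seteqP; split=> tau [k kt sk]; exists k.
have mS t : measurable [set tau | s t tau <> None].
  exact: (measurableC (s_meas t None)).
have mN t : measurable (F t `&` [set tau | s t tau <> None]).
  exact: measurableI.
have N0 t : Q (F t `&` [set tau | s t tau <> None]) = 0%E.
  elim: t => [|t IH].
    rewrite (_ : _ `&` _ = set0) ?measure0 //.
    rewrite -subset0 => tau [[k]]; rewrite leqn0 => /eqP -> sk.
    by rewrite /= sk.
  have mB : measurable ([set tau | s t tau = None]
      `&` [set tau | s t.+1 tau <> None]).
    exact: measurableI.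
  have B0 : Q ([set tau | s t tau = None]
      `&` [set tau | s t.+1 tau <> None]) = 0%E.
    rewrite (total_prob t.+1) // big1 // => -[k|] _.
      apply: (@subset_measure0 _ _ _ _ _ ([set tau | s t tau = None]
        `&` [set tau | s t.+1 tau = Some k])) => //.
      - exact: measurableI.
      - exact: measurableI.
      - by move=> tau [[? _] ?]; split.
      - by apply: etrans (markov_step _ _ _) _; rewrite mule0.
    rewrite (_ : _ `&` _ = set0) ?measure0 //.
    by rewrite -subset0 => tau [[_ st1]]; rewrite /= => /st1.
  apply: (@subset_measure0 _ _ _ _ _ ((F t `&` [set tau | s t tau <> None])
    `|` ([set tau | s t tau = None] `&` [set tau | s t.+1 tau <> None]))) => //.
  - exact: measurableU.
  - move=> tau [[k kt sk] st1].
    have [st|st] := pselect (s t tau = None); [by right|left; split=> //].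
    exists k => //; move: kt; rewrite leq_eqVlt => /orP[/eqP kt|//].
    by rewrite -kt in st1.
  - by apply: etrans (measureU0 _ _ _) _ => //; rewrite B0.
have FU : \bigcup_t F t = [set tau | exists t, s t tau = None].
  apply/seteqP; split=> tau; first by move=> [t _ [k _ ?]]; exists k.
  by move=> [t ?]; exists t => //; exists t.
have Fcvg : (Q \o F) @ \oo --> 1%E.
  rewrite -proper -FU; apply: nondecreasing_cvg_mu => //.
    exact: bigcupT_measurable.
  move=> u v uv; apply/subsetPset => tau [k ku sk]; exists k => //.
  exact: leq_trans uv.
have le1 t : (P_of M m ^+ t) i j <= 1 - fine (Q (F t)).
  have Ffin : Q (F t) \is a fin_num by exact: fin_num_measure.
  rewrite -lee_fin EFinB fineK // -chain_marginal -(probability_setC Q (mF t)).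
  rewrite -[leRHS](measureU0 (measurableC (mF t)) (mN t) (N0 t)).
  apply: le_measure; rewrite ?inE //; first exact: measurableU (measurableC _) _.
  move=> tau /= st; have [?|?] := pselect (F t tau); [right|by left].
  by split=> //; rewrite /= st.
apply: (@squeeze_cvgr _ _ _ _ (cst 0) (fun t => 1 - fine (Q (F t)))).
- by near=> t; rewrite le1 -lee_fin -chain_marginal measure_ge0.
- exact: cvg_cst.
- rewrite -[X in _ --> X](subrr (1 : R)); apply: cvgB; first exact: cvg_cst.
  exact: fine_cvg Fcvg.
Unshelve. all: by end_near.
Qed.

Hypothesis P_transient :
  forall k j, (P_of M m ^+ t) k j @[t --> \oo] --> 0.

(** The partial sums are dominated by the total absolute cost G, which is
    integrable because its expectation is the convergent series of the
    P^t |g|. Finiteness of G almost everywhere also gives the convergence of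
    the partial sums. *)
Lemma expected_total_cost :
  ('E_Q[total_cost M s m])%E = ((potential (P_of M m) *m g_of M m) i ord0)%:E.
Proof.
pose c := stage_cost M m.
pose f T tau := (series (fun t => c (s t tau)) T)%:E.
pose G tau := (\sum_(0 <= t <oo) `|c (s t tau)|%:E)%E.
have mc t : measurable_fun setT (fun tau => c (s t tau)) by exact: stage_meas.
have mS T : measurable_fun setT (fun tau => series (fun t => c (s t tau)) T).
  exact: measurable_sum.
have mG : measurable_fun setT G.
  apply: ge0_emeasurable_sum => // t _.
  by apply/measurable_EFinP; exact: (stage_meas t (fun x => `|c x|)).
have IG : (\int[Q]_tau G tau < +oo)%E.
  rewrite integral_nneseries //; last first.
    by move=> t; apply/measurable_EFinP; exact: (stage_meas t (fun x => `|c x|)).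
  rewrite (eq_eseriesr (fun t _ => @integral_stage t (fun x => `|c x|) (normr0 _))).
  have cv := @series_pow_cvg _ _ _ P_transient (\col_j `|c (Some j)|) i.
  rewrite (_ : limn _ = ((potential (P_of M m) *m \col_j `|c (Some j)|) i ord0)%:E).
    by rewrite ltry.
  apply/cvg_lim => //; rewrite (_ : (fun _ => _) = EFin \o
     series (fun t => (P_of M m ^+ t *m \col_j `|c (Some j)|) i ord0)).
    by apply: cvg_EFin; [exact: nearW|exact: cv].
  by apply/funext => T; rewrite /= sumEFin.
have G0 tau : (0 <= G tau)%E by apply: nneseries_ge0.
have iG : Q.-integrable setT G.
  apply/integrableP; split => //.
  by under eq_integral do rewrite gee0_abs //.
have [||||_ _ fcvg] := @dominated_convergence _ _ _ Q setT measurableT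
  f (EFin \o total_cost M s m) G _ _ _ iG _.
- by move=> T; apply/measurable_EFinP; exact: mS.
- by apply/measurable_EFinP; exact: measurable_fun_limn.
- have := integrable_ae measurableT iG; apply: filterS => tau Gfin _.
  apply: cvg_EFin; first exact: nearW.
  apply: normed_cvg; apply: nnseries_is_cvg => [k|]; first exact: normr_ge0.
  by have := Gfin Logic.I; rewrite (ge0_fin_numE (G0 tau)); exact.
- apply: nearW => tau T _; rewrite /f /series /=.
  apply: (@le_trans _ _ (\sum_(0 <= t < T) `|c (s t tau)|%:E)%E).
    by rewrite sumEFin lee_fin ler_norm_sum.
  by apply: nneseries_lim_ge => t _ _; rewrite lee_fin.
have -> : ('E_Q[total_cost M s m])%E = (\int[Q]_tau (total_cost M s m tau)%:E)%E.
  by rewrite unlock.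
have cv := @series_pow_cvg _ _ _ P_transient (g_of M m) i.
have fT T : (\int[Q]_tau f T tau)%E =
    (series (fun t => (P_of M m ^+ t *m g_of M m) i ord0) T)%:E.
  rewrite /f /series /=; under eq_integral do rewrite -sumEFin.
  rewrite integral_sum //; last first.
    move=> t; apply: (le_integrable measurableT _ _ iG).
      by apply/measurable_EFinP; exact: mc.
    move=> tau _ /=; rewrite (gee0_abs (G0 tau)).
    apply: le_trans (nneseries_lim_ge t.+1 _) => [|k _ _]; last by rewrite lee_fin.
    rewrite big_nat_recr //= leeDr // sumEFin lee_fin sumr_ge0 //.
  rewrite -sumEFin; apply: eq_bigr => t _.
  rewrite (@integral_stage t c (erefl _)).
  suff -> : \col_j c (Some j) = g_of M m by [].
  by apply/colP => j; rewrite !mxE.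
have fT' : (fun T => \int[Q]_tau f T tau)%E @ \oo -->
    ((potential (P_of M m) *m g_of M m) i ord0)%:E.
  rewrite (_ : (fun T => _) = EFin \o
    series (fun t => (P_of M m ^+ t *m g_of M m) i ord0)); last exact/funext.
  by apply: cvg_EFin; [exact: nearW|exact: cv].
exact: (cvg_unique (@ereal_hausdorff R) fcvg fT').
Qed.
End chain_law.

(** * Orthogonality to the past *)

Section sub_sigma_algebra.
Import HBNNSimple.
Context d (Omega : measurableType d) (R : realType).
Variable P : probability Omega R.

Definition adapted_to (G : set (set Omega)) (f : Omega -> R) :=
  measurable_fun setT (f : g_sigma_algebraType G -> R).

Lemma adapted_toP G f : adapted_to G f <->
  forall B : set R, measurable B -> <<s G >> (f @^-1` B).
Proof.
split=> [fG B mB|fG _ B mB]; last by rewrite setTI; exact: fG.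
by rewrite -[_ @^-1` _]setTI; exact: (fG measurableT B mB).
Qed.

Lemma adapted_toW G f : <<s G >> `<=` measurable ->
  adapted_to G f -> measurable_fun setT f.
Proof.
by move=> Gm /adapted_toP fG _ B mB; rewrite setTI; apply: Gm; exact: fG.
Qed.

Lemma adapted_to_sub G G' f : <<s G >> `<=` <<s G' >> ->
  adapted_to G f -> adapted_to G' f.
Proof.
move=> GG' /adapted_toP fG; apply/adapted_toP => B mB.
by apply: GG'; exact: fG.
Qed.

Variable G : set (set Omega).
Hypothesis Gm : <<s G >> `<=` measurable.
Variable w : Omega -> R.
Hypothesis w_int : P.-integrable setT (EFin \o w).
Hypothesis w0 : forall E, <<s G >> E -> (\int[P]_(om in E) (w om)%:E = 0)%E.

Let integral_indic_mul E : <<s G >> E ->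
  (\int[P]_om (\1_E om * w om)%:E = 0)%E.
Proof.
move=> GE; apply: etrans (w0 GE); rewrite [RHS]integral_mkcond.
apply: eq_integral => om _.
by rewrite epatch_indic /= -EFinM mulrC.
Qed.

Let w_meas : measurable_fun setT w.
Proof. by case/integrableP : w_int => /measurable_EFinP. Qed.

Let integral_mul_ge0 (Z : Omega -> R) : adapted_to G Z ->
  (forall om, 0 <= Z om) ->
  P.-integrable setT (EFin \o (Z \* w)) ->
  (\int[P]_om (Z om * w om)%:E = 0)%E.
Proof.
move=> ZG Z0 Zw_int.
(* Approximating in the sigma-algebra generated by G, and not in that of Omega,
   puts the level sets of the simple functions in the generated one. *)
pose T := g_sigma_algebraType G.
have mZ : measurable_fun setT (EFin \o Z : T -> \bar R) by exact/measurable_EFinP.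
pose h := nnsfun_approx (measurableT : measurable [set: T]) mZ.
pose g (k : nat) : Omega -> R := h k.
pose values k := finmap.enum_fset (fset_set (range (g k))).
have gE k om : g k om =
    \sum_(r <- values k) r * \1_(g k @^-1` [set r]) om.
  by have := fimfunE (h k) om; rewrite fsbig_finite.
have gG k B : measurable B -> <<s G >> (g k @^-1` B).
  by move=> mB; rewrite -[_ @^-1` _]setTI; exact: (@measurable_funPT _ _ T R (h k)).
have mg k : measurable_fun setT (g k).
  by move=> _ B mB; rewrite setTI; apply: Gm; exact: gG.
have g_le k om : 0 <= g k om <= Z om.
  rewrite /g; apply/andP; split; first exact: fun_ge0.
  rewrite nnsfun_approxE -lee_fin; apply: (@le_approx _ T R setT (EFin \o Z)) => //.
  by move=> *; rewrite lee_fin.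
have gcvg om : g ^~ om @ \oo --> Z om.
  have Z0' t : [set: T] t -> (0 <= (EFin \o Z) t)%E by rewrite lee_fin.
  exact: (fine_cvg (cvg_nnsfun_approx measurableT mZ Z0' (x := om) Logic.I)).
have gw0 k : (\int[P]_om (g k om * w om)%:E = 0)%E.
  transitivity (\int[P]_om (\sum_(r <- values k)
      r%:E * (\1_(g k @^-1` [set r]) om * w om)%:E))%E.
    apply: eq_integral => om _; rewrite [in LHS]gE mulr_suml -sumEFin.
    by apply: eq_bigr => r _; rewrite -EFinM mulrA.
  have int1 r : P.-integrable setT
      (fun om => (\1_(g k @^-1` [set r]) om * w om)%:E).
    apply: (le_integrable measurableT _ _ w_int).
      apply/measurable_EFinP; apply: measurable_funM => //.
      by apply: measurable_indic; rewrite -[_ @^-1` _]setTI; exact: mg.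
    move=> om _ /=; rewrite lee_fin normrM ler_piMl // indicE.
    by case: (_ \in _); rewrite ?normr1 ?normr0.
  rewrite integral_sum //; last by move=> r; exact: integrableZl.
  rewrite big1 // => r _; rewrite integralZl // integral_indic_mul ?mule0 //.
  exact: gG.
have [|||| _ _] := @dominated_convergence _ _ _ P setT measurableT
  (fun k om => (g k om * w om)%:E) (EFin \o (Z \* w))
  (abse \o (EFin \o (Z \* w))) _ _ _ (integrable_abse Zw_int) _.
- by move=> k; apply/measurable_EFinP; exact: measurable_funM.
- exact: measurable_int Zw_int.
- apply: nearW => om _ /=; apply: cvg_EFin; first exact: nearW.
  by apply: cvgMr_tmp; exact: gcvg.
- apply: nearW => om k _ /=; rewrite lee_fin !normrM ler_wpM2r //.
  by have /andP[? ?] := g_le k om; rewrite !ger0_norm // (le_trans _ (_ : g k om <= _)).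
under eq_fun do rewrite gw0.
move=> /(cvg_lim (@ereal_hausdorff R)); rewrite lim_cst //.
Qed.

(** A variable with zero conditional mean is orthogonal to every adapted Z. The
    hypothesis is the case of an indicator; the positive and negative parts of
    Z are limits of simple functions of the smaller sigma-algebra, and Z w
    dominates the products. *)
Lemma integral_adapted_mul (Z : Omega -> R) : adapted_to G Z ->
  P.-integrable setT (EFin \o (Z \* w)) ->
  (\int[P]_om (Z om * w om)%:E = 0)%E.
Proof.
move=> ZG Zw_int.
have part_int (Z' : Omega -> R) : adapted_to G Z' ->
    (forall om, `|Z' om| <= `|Z om|) ->
    P.-integrable setT (EFin \o (Z' \* w)).
  move=> Z'G Z'le; apply: (le_integrable measurableT _ _ Zw_int).
    by apply/measurable_EFinP/measurable_funM => //; exact: adapted_toW Z'G.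
  by move=> om _ /=; rewrite lee_fin !normrM ler_wpM2r.
have pG : adapted_to G Z^\+ by exact: measurable_funrpos.
have nG : adapted_to G Z^\- by exact: measurable_funrneg.
have p_int : P.-integrable setT (EFin \o (Z^\+ \* w)).
  apply: part_int => // om; rewrite ger0_norm ?funrpos_ge0 //.
  by rewrite /funrpos ge_max ler_norm normr_ge0.
have n_int : P.-integrable setT (EFin \o (Z^\- \* w)).
  apply: part_int => // om; rewrite ger0_norm ?funrneg_ge0 //.
  by rewrite /funrneg ge_max -normrN ler_norm normr_ge0.
transitivity (\int[P]_om ((Z^\+ om * w om)%:E - (Z^\- om * w om)%:E))%E.
  apply: eq_integral => om _; rewrite -EFinB -mulrBl.
  by rewrite -[in LHS](funrposBneg Z).
rewrite integralB // !integral_mul_ge0 // ?sube0 //.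
Qed.

End sub_sigma_algebra.

(** * Convergence of square-summable martingales *)

Section square_integrable.
Context d (Omega : measurableType d) (R : realType).
Variable P : probability Omega R.

Definition square_integrable (f : Omega -> R) :=
  P.-integrable setT (fun om => (f om ^+ 2)%:E).

Lemma square_integrable_cst (r : R) : square_integrable (cst r).
Proof. exact: (finite_measure_integrable_cst P (r ^+ 2)). Qed.

Lemma square_integrable_mul (f g : Omega -> R) :
  measurable_fun setT f -> measurable_fun setT g ->
  square_integrable f -> square_integrable g ->
  P.-integrable setT (EFin \o (f \* g)).
Proof.
move=> mf mg f2 g2; have fg2 := integrableD measurableT f2 g2.
apply: (le_integrable measurableT _ _ fg2) => [|om _ /=].
  by apply/measurable_EFinP; exact: measurable_funM.
rewrite lee_fin normrM [leRHS]ger0_norm ?addr_ge0 ?sqr_ge0 //.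
rewrite -(real_normK (num_real (f om))) -(real_normK (num_real (g om))).
have := normr_ge0 (f om); have := normr_ge0 (g om).
move: `|f om| `|g om| => a b a0 b0.
have := sqr_ge0 (a - b); have := mulr_ge0 a0 b0; rewrite sqrrB; lra.
Qed.

Lemma square_integrable_integrable (f : Omega -> R) :
  measurable_fun setT f -> square_integrable f ->
  P.-integrable setT (EFin \o f).
Proof.
move=> mf f2.
have := @square_integrable_mul (cst 1) f (measurable_cst _) mf
  (square_integrable_cst 1) f2.
by apply: eq_integrable => // om _ /=; rewrite mul1r.
Qed.

End square_integrable.

Section stopped_sum.
Variables (R : realType) (eps : R).

(** The partial sums of x, frozen at the first time they reach eps in absolute
    value. The stopping test reads the frozen sum itself: as long as it has
    not triggered, both sums agree. *)
Fixpoint stopped_sum (x : nat -> R) (n : nat) : R :=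
  if n is k.+1 then
    stopped_sum x k + (if `|stopped_sum x k| < eps then x k else 0)
  else 0.

Lemma stopped_sum_stays (x : nat -> R) k n : (k <= n)%N ->
  eps <= `|stopped_sum x k| -> eps <= `|stopped_sum x n|.
Proof.
move=> /subnKC <-; elim: (n - k)%N => [|j IH]; first by rewrite addn0.
by move=> /IH ej; rewrite addnS /= ltNge ej /= addr0.
Qed.

Lemma stopped_sumE (x : nat -> R) n : `|stopped_sum x n| < eps ->
  stopped_sum x n = series x n.
Proof.
elim: n => [|n IH]; first by rewrite /series /= big_nil.
rewrite /series /= big_nat_recr //=.
have [lt _|le] := ltP `|stopped_sum x n| eps; first by rewrite IH.
by rewrite addr0 ltNge le.
Qed.

End stopped_sum.

Record square_martingale_differences d (Omega : measurableType d)
    (R : realType) (P : probability Omega R) (G : nat -> set (set Omega))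
    (x : nat -> Omega -> R) (c : nat -> R) : Prop := {
  diff_sub_measurable : forall t, <<s G t >> `<=` measurable;
  diff_filtration : forall t, <<s G t >> `<=` <<s G t.+1 >>;
  diff_adapted : forall t, adapted_to (G t.+1) (x t);
  diff_mean0 : forall t E, <<s G t >> E ->
    (\int[P]_(om in E) (x t om)%:E = 0)%E;
  diff_square : forall t, square_integrable P (x t);
  diff_variance : forall t, (\int[P]_om (x t om ^+ 2)%:E <= (c t)%:E)%E
}.

Section maximal_inequality.
Context d (Omega : measurableType d) (R : realType).
Variable P : probability Omega R.
Variables (G : nat -> set (set Omega)) (x : nat -> Omega -> R) (c : nat -> R).
Hypothesis mds : square_martingale_differences P G x c.

Let G_meas := diff_sub_measurable mds.
Let G_mono := diff_filtration mds.
Let x_adapted := diff_adapted mds.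
Let x_mean := diff_mean0 mds.
Let x_sq := diff_square mds.
Let x_var := diff_variance mds.

Let x_meas t : measurable_fun setT (x t).

Proof. exact: adapted_toW (@G_meas _) (@x_adapted t). Qed.

Variable eps : R.
Let T n om := stopped_sum eps (x ^~ om) n.

Lemma stopped_sum_adapted n : adapted_to (G n) (T n).
Proof.
elim: n => [|n IH]; first exact: measurable_cst.
have {}IH := adapted_to_sub (@G_mono n) IH.
apply: measurable_funD => //.
apply: measurable_fun_ifT; [|exact: x_adapted|exact: measurable_cst].
by apply: measurable_fun_ltr => //; exact: measurableT_comp.
Qed.

(** The cross term of the square is twice the integral of x_n times the stopped
    sum restricted to the event of not having stopped, which is adapted, so it
    vanishes. *)
Lemma stopped_sum_square n : square_integrable P (T n) /\
  (\int[P]_om (T n om ^+ 2)%:E <= (\sum_(0 <= k < n) c k)%:E)%E.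
Proof.
elim: n => [|n [IHs IH]].
  split; first exact: (square_integrable_cst P 0).
  by rewrite big_nil integral0_eq // => om _ /=; rewrite expr0n.
pose Z om := if `|T n om| < eps then T n om else 0.
pose y om := if `|T n om| < eps then x n om else 0.
have TG := @stopped_sum_adapted n.
have Tm := adapted_toW (@G_meas n) TG.
have ltm : measurable_fun setT (fun om => `|T n om| < eps).
  by apply: measurable_fun_ltr => //; exact: measurableT_comp.
have ZG : adapted_to (G n) Z.
  apply: measurable_fun_ifT => //.
  by apply: measurable_fun_ltr => //; exact: measurableT_comp.
have Zm := adapted_toW (@G_meas n) ZG.
have ym : measurable_fun setT y by exact: measurable_fun_ifT.
have Zs : square_integrable P Z.
  apply: (le_integrable measurableT _ _ IHs).
    by apply/measurable_EFinP; exact: measurable_funX.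
  move=> om _; rewrite /= lee_fin /Z; case: ifP => // _.
  by rewrite expr0n normr0.
have y_le om : y om ^+ 2 <= x n om ^+ 2.
  by rewrite /y; case: ifP => // _; rewrite expr0n sqr_ge0.
have ys : square_integrable P y.
  apply: (le_integrable measurableT _ _ (x_sq n)).
    by apply/measurable_EFinP; exact: measurable_funX.
  by move=> om _; rewrite /= lee_fin !ger0_norm ?sqr_ge0.
have Zx := square_integrable_mul Zm (x_meas n) Zs (x_sq n).
have Zx2 : P.-integrable setT (fun om => 2%:E * (Z om * x n om)%:E)%E.
  exact: integrableZl.
have sqE om : (T n.+1 om ^+ 2)%:E =
    ((T n om ^+ 2)%:E + (2%:E * (Z om * x n om)%:E + (y om ^+ 2)%:E))%E.
  rewrite -EFinM -!EFinD; congr EFin.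
  rewrite /T /= -/(T n om) /Z /y; case: ifP => _; ring.
have i2 := integrableD measurableT Zx2 ys.
split.
  rewrite /square_integrable (_ : (fun _ => _) = (fun om => (T n om ^+ 2)%:E) \+
    ((fun om => 2%:E * (Z om * x n om)%:E) \+ (fun om => (y om ^+ 2)%:E)))%E.
    exact: integrableD.
  by apply/funext => om; rewrite sqE.
have -> : (\int[P]_om (T n.+1 om ^+ 2)%:E = \int[P]_om (T n om ^+ 2)%:E +
    (\int[P]_om (2%:E * (Z om * x n om)%:E) + \int[P]_om (y om ^+ 2)%:E))%E.
  rewrite -(integralD measurableT Zx2 ys) -(integralD measurableT IHs i2).
  by apply: eq_integral => om _; exact: sqE.
rewrite integralZl //.
rewrite (integral_adapted_mul (@G_meas n) _ (@x_mean n) ZG Zx); last first.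
  exact: square_integrable_integrable.
rewrite mule0 add0e big_nat_recr //= EFinD; apply: leeD => //.
apply: le_trans (x_var n); apply: ge0_le_integral => //.
- by move=> om _; rewrite lee_fin sqr_ge0.
- by apply/measurable_EFinP; exact: measurable_funX.
- by apply/measurable_EFinP; exact: measurable_funX.
- by move=> om _; rewrite lee_fin.
Qed.

(** Kolmogorov's inequality: some partial sum reaches eps exactly when the
    stopped sum ends up at eps or above, and Chebyshev bounds the latter
    uniformly in the horizon. *)
Lemma maximal_inequality C : 0 < eps ->
  (forall n, \sum_(0 <= k < n) c k <= C) ->
  exists B, [/\ measurable B, (P B <= (C / eps ^+ 2)%:E)%E &
    forall om, ~ B om -> forall n, `|series (x ^~ om) n| < eps].
Proof.
move=> eps0 cC; pose B n := [set om | eps <= `|T n om|].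
have Tm n := adapted_toW (@G_meas n) (@stopped_sum_adapted n).
have mB n : measurable (B n).
  rewrite -[B n]setTI; apply: (measurable_fun_le (f := cst eps)) => //.
  exact: measurableT_comp.
exists (\bigcup_n B n); split.
- exact: bigcupT_measurable.
- have Bcvg : (P \o B) @ \oo --> P (\bigcup_n B n).
    apply: nondecreasing_cvg_mu => //; first exact: bigcupT_measurable.
    by move=> k n kn; apply/subsetPset => om; exact: stopped_sum_stays.
  apply: (cvge_to_le Bcvg).
    apply: nearW => n /=; have [_ vT] := stopped_sum_square n.
    have e20 : 0 < eps ^+ 2 by rewrite exprn_gt0.
    rewrite mulrC EFinM lee_pdivlMl //.
    have mT2 : measurable_fun setT (fun om => (T n om ^+ 2)%:E).
      by apply/measurable_EFinP; exact: measurable_funX.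
    have := le_integral_abse P measurableT mT2 e20; rewrite setTI.
    rewrite (_ : [set om | _] = B n); last first.
      apply/funext => om; rewrite /B /= lee_fin ger0_norm ?sqr_ge0 //.
      rewrite -(real_normK (num_real (T n om))) ler_pXn2r ?nnegrE //.
      exact: ltW.
    move=> /le_trans; apply; apply: le_trans (_ : _ <= (\sum_(0 <= k < n) c k)%:E)%E _.
      by under eq_integral do rewrite gee0_abs ?lee_fin ?sqr_ge0 //.
    by rewrite lee_fin.
- move=> om nB n; have ltT : `|T n om| < eps.
    by rewrite ltNge; apply/negP => le; apply: nB; exists n.
  by rewrite -(stopped_sumE ltT).
Qed.

End maximal_inequality.

Lemma square_martingale_differences_shift d (Omega : measurableType d)
    (R : realType) (P : probability Omega R) (G : nat -> set (set Omega))
    (x : nat -> Omega -> R) (c : nat -> R) m :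
  square_martingale_differences P G x c ->
  square_martingale_differences P (fun k => G (m + k)%N)
    (fun k => x (m + k)%N) (fun k => c (m + k)%N).
Proof.
case=> G_meas G_mono x_adapted x_mean x_sq x_var; split=> t /=.
- exact: G_meas.
- by rewrite addnS; exact: G_mono.
- by rewrite addnS; exact: x_adapted.
- exact: x_mean.
- exact: x_sq.
- exact: x_var.
Qed.

(** Apply the maximal inequality after time m: the fluctuations beyond eps have
    probability at most r_m / eps^2, where r_m is the tail of the variances.
    Hence almost surely some m has fluctuations below eps, and the partial
    sums are Cauchy. *)
Theorem martingale_series_cvg d (Omega : measurableType d) (R : realType)
    (P : probability Omega R) (G : nat -> set (set Omega))
    (x : nat -> Omega -> R) (c : nat -> R) :
  square_martingale_differences P G x c ->
  (forall t, 0 <= c t) -> cvgn (series c) ->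
  {ae P, forall om, cvgn (series (x ^~ om))}.
Proof.
move=> mds c0 ccvg.
have tail (u : nat -> R) m n : \sum_(0 <= k < n) u (m + k)%N =
    series u (m + n)%N - series u m.
  rewrite sub_series_geq ?leq_addr // -[X in _ = \sum_(X <= _ < _) _]add0n.
  by rewrite big_addn addKn; apply: eq_bigr => k _; rewrite addnC.
pose r m := limn (series c) - series c m.
have rle m n : \sum_(0 <= k < n) c (m + k)%N <= r m.
  rewrite tail lerD2r; apply: nondecreasing_cvgn_le => //.
  exact: nondecreasing_series.
have rcvg : r @ \oo --> 0.
  rewrite -[X in _ --> X](subrr (limn (series c))); apply: cvgB => //.
  exact: cvg_cst.
suff ae_p p : {ae P, forall om, exists m, forall j,
    `|series (x ^~ om) (m + j)%N - series (x ^~ om) m| <= p.+1%:R^-1}.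
  have := ae_foralln ae_p; apply: filterS => om H.
  by apply/cvgn_cauchyP => p; exact: H.
have : 0 < p.+1%:R^-1 :> R by rewrite invr_gt0.
move: (p.+1%:R^-1) => eps eps0.
have /choice[B HB] m :=
  maximal_inequality (square_martingale_differences_shift m mds) eps0 (rle m).
pose N := \bigcap_m B m.
have mN : measurable N.
  by apply: bigcap_measurableType => m _; have [] := HB m.
exists N; split=> //.
- apply/eqP; rewrite eq_le measure_ge0 andbT.
  have cv : (fun m => (r m / eps ^+ 2)%:E) @ \oo --> 0%E.
    apply: cvg_EFin; first exact: nearW.
    by rewrite -[X in _ --> X](mul0r (eps ^+ 2)^-1); exact: cvgMr_tmp.
  apply: (cvge_to_ge cv); apply: nearW => m; have [mB PB _] := HB m.
  by apply: le_trans PB; apply: le_measure; rewrite ?inE //; exact: bigcap_inf.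
- move=> om /=; apply: contra_notP => /existsNP[m /not_implyP[_ nB]].
  exists m => j; have [_ _ /(_ om nB j)] := HB m.
  by rewrite -tail => /ltW.
Qed.

(** * The recursion along one path *)

Lemma eq_is_cvg_series (R : realType) (u v : nat -> R) : u =1 v ->
  cvgn (series u) -> cvgn (series v).
Proof. by move=> /funext ->. Qed.

Lemma is_cvg_series_lincomb (R : realType) (I : finType) (a : I -> R)
    (u : I -> nat -> R) :
  (forall k, cvgn (series (u k))) ->
  cvgn (series (fun t => \sum_k a k * u k t)).
Proof.
move=> ucvg; apply: cvgP.
rewrite (_ : series _ = fun t => \sum_k a k * series (u k) t); last first.
  apply/funext => t; rewrite /series /= exchange_big /=.
  by apply: eq_bigr => k _; rewrite mulr_sumr.
apply: (@cvg_big _ _ +%R 0 xpredT (@add_continuous R)) => k _.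
by apply: cvgMl_tmp; exact: ucvg.
Qed.

Section min_over.
Variables (R : realType) (X : finType) (x0 : X) (F : X -> R).

Lemma min_over_le x : min_over x0 F <= F x.
Proof. by rewrite /min_over; case: arg_minP => // y _; apply. Qed.

Lemma min_over_attained : exists x, min_over x0 F = F x.
Proof. by eexists. Qed.

End min_over.

(** Maximum principle: at an index i maximizing c = y / xi, a positive c would
    give y i <= c (xi i - 1) < c xi i = y i. *)
Lemma subharmonic_le0 (R : realType) (I : finType) (p : I -> I -> R)
    (xi y : I -> R) :
  (forall i j, 0 <= p i j) ->
  (forall i, 1 <= xi i) ->
  (forall i, \sum_j p i j * xi j <= xi i - 1) ->
  (forall i, y i <= \sum_j p i j * y j) ->
  forall i, y i <= 0.
Proof.
move=> p0 xi1 pxi ysub i0.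
have xi0 i : 0 < xi i by apply: lt_le_trans (xi1 i).
have [i _ imax] := @arg_maxP _ _ _ i0 xpredT (fun i => y i / xi i) isT.
set c := y i / xi i in imax.
have yc j : y j <= c * xi j by rewrite -ler_pdivrMr //; exact: imax.
suff c0 : c <= 0 by apply: le_trans (yc i0) _; rewrite mulr_le0_ge0 // ltW.
rewrite leNgt; apply/negP => c0.
have yi : y i = c * xi i by rewrite /c divfK // gt_eqF.
have : y i <= c * (xi i - 1).
  apply: le_trans (ysub i) _.
  apply: le_trans (_ : c * \sum_j p i j * xi j <= _); last by rewrite ler_pM2l.
  by rewrite mulr_sumr ler_sum // => j _; rewrite mulrCA ler_wpM2l.
rewrite yi; nra.
Qed.

Section pathwise.
Variables (R : realType) (n : nat) (A : finType) (a0 : A) (M : ssp R n A).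
Variables (V xi : policy n A -> 'cV[R]_n).
Hypothesis V_bellman : forall m, V m = bellman_mu M m (V m).
Hypothesis xi_ge0 : forall m i, 0 <= xi m i ord0.
Hypothesis xi_time : forall m, xi m = const_mx 1 + P_of M m *m xi m.

Let p m i j := P_of M m i j.

Let p_ge0 m i j : 0 <= p m i j.
Proof. by rewrite /p mxE tprob_ge0. Qed.

Let p_sum m i : \sum_j p m i j <= 1.
Proof. by under eq_bigr do rewrite /p mxE; exact: tprob_sum_le1. Qed.

Let xiE m i : xi m i ord0 = 1 + \sum_j p m i j * xi m j ord0.
Proof. by rewrite {1}xi_time !mxE. Qed.

Let xi_ge1 m i : 1 <= xi m i ord0.
Proof. by rewrite xiE lerDl sumr_ge0 // => j _; exact: mulr_ge0. Qed.

Let p_xi m i : \sum_j p m i j * xi m j ord0 <= xi m i ord0 - 1.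
Proof. by rewrite [in leRHS]xiE; lra. Qed.

Let bellman_muE m (H : 'cV[R]_n) i :
  bellman_mu M m H i ord0 = cost M i (m i) + \sum_j p m i j * H j ord0.
Proof. by rewrite /bellman_mu !mxE. Qed.

Let VE m i : V m i ord0 = cost M i (m i) + \sum_j p m i j * V m j ord0.
Proof. by rewrite {1}V_bellman bellman_muE. Qed.

Lemma bellman_le m (H : 'cV[R]_n) i :
  bellman M a0 H i ord0 <= bellman_mu M m H i ord0.
Proof.
rewrite mxE bellman_muE; apply: le_trans (min_over_le _ _ (m i)) _.
by under [in leRHS]eq_bigr do rewrite /p mxE.
Qed.

(** The vector V m - H - e xi is subharmonic for P_m, since V m - H equals the
    residual plus P_m (V m - H), and e xi pays e at every step. *)
Lemma residual_bound m (H : 'cV[R]_n) e : 0 <= e ->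
  (forall i, bellman_mu M m H i ord0 - H i ord0 <= e) ->
  forall i, V m i ord0 <= bellman_mu M m H i ord0 + e * xi m i ord0.
Proof.
move=> e0 He.
have VH i : V m i ord0 - H i ord0 - e * xi m i ord0 <= 0.
  move: i; apply: (@subharmonic_le0 _ _ (p m) (fun i => xi m i ord0)) => //= i.
  under eq_bigr do rewrite !mulrBr mulrCA.
  rewrite !sumrB -mulr_sumr.
  have := He i; rewrite bellman_muE; have := VE m i; have := xiE m i.
  set s1 := \sum_j _; set s2 := \sum_j _; set s3 := \sum_j _.
  move=> -> -> ; lra.
move=> i; rewrite VE bellman_muE -addrA lerD2l.
apply: le_trans (_ : \sum_j p m i j * (H j ord0 + e * xi m j ord0) <= _).
  apply: ler_sum => j _; apply: ler_wpM2l => //; have := VH j; lra.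
under eq_bigr do rewrite mulrDr mulrCA.
rewrite big_split /= lerD2l -mulr_sumr ler_wpM2l // (le_trans (p_xi m i)) //; lra.
Qed.

Variables (gamma : nat -> R) (J w : nat -> 'cV[R]_n) (mu : nat -> policy n A).
Hypothesis gamma_ge0 : forall t, 0 <= gamma t.
Hypothesis gamma_cvg0 : gamma @ \oo --> 0.
Hypothesis gamma_div : series gamma @ \oo --> +oo.
Hypothesis noise_cvg : forall m j,
  cvgn (series (fun t => if mu t == m then gamma t * w t j ord0 else 0)).
Hypothesis mu_greedy : forall t, greedy M a0 (mu t) (J t).
Hypothesis J_rec : forall t,
  J t.+1 = (1 - gamma t) *: J t + gamma t *: (V (mu t) + w t).

Let J_recE t i : J t.+1 i ord0 = (1 - gamma t) * J t i ord0
  + gamma t * (V (mu t) i ord0 + w t i ord0).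
Proof. by rewrite J_rec !mxE. Qed.

(** The coefficients may depend on the current policy: there are finitely many
    policies, and the noise is summable along each of them. *)
Lemma noise_lincomb_cvg (a : policy n A -> 'I_n -> R) :
  cvgn (series (fun t => gamma t * \sum_j a (mu t) j * w t j ord0)).
Proof.
apply: eq_is_cvg_series (@is_cvg_series_lincomb R (policy n A * 'I_n)%type
  (fun k => a k.1 k.2)
  (fun k t => if mu t == k.1 then gamma t * w t k.2 ord0 else 0)
  (fun k => @noise_cvg k.1 k.2)) => t.
rewrite -(pair_bigA _ (fun m j => a m j *
  (if mu t == m then gamma t * w t j ord0 else 0))) /=.
rewrite (bigD1 (mu t)) //= [X in _ + X]big1 ?addr0.
  by rewrite mulr_sumr; apply: eq_bigr => j _; rewrite eqxx mulrCA.
by move=> m nm; rewrite big1 // => j _; rewrite eq_sym (negbTE nm) mulr0.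
Qed.

Lemma noise_coordinate_cvg (r : R) i :
  cvgn (series (fun t => gamma t * (r * w t i ord0))).
Proof.
apply: eq_is_cvg_series
  (@noise_lincomb_cvg (fun _ j => if j == i then r else 0)) => t.
congr (_ * _).
rewrite (bigD1 i) //= eqxx big1 ?addr0 // => j /negbTE ->.
by rewrite mul0r.
Qed.

(* The drift lemma with transition matrix 0 and weights 1. *)
Let drift0 (U v : nat -> 'I_n -> R) :
  (forall i, cvgn (series (fun t => gamma t * v t i))) ->
  (forall t i, U t.+1 i <= (1 - gamma t) * U t i + gamma t * v t i) ->
  forall delta, 0 < delta -> \forall t \near \oo, forall i, U t i <= delta.
Proof.
move=> vcvg Urec delta delta0.
have z (u : 'I_n -> R) : \sum_j 0 * u j = 0.
  by rewrite big1 // => j _; rewrite mul0r.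
have : \forall t \near \oo, forall i, U t i <= (0 + delta) * 1.
  apply: (@drift_limsup R 'I_n (fun _ _ => 0) (fun=> 1) gamma U v) => //.
  - by move=> i; rewrite big1.
  - by move=> i; rewrite z subrr.
  - by apply: nearW => t i; rewrite z !add0r.
by apply: filterS => t Ut i; have := Ut i; rewrite add0r mulr1.
Qed.

(** The policy greedy for J_t is a competitor in T J_(t+1), and T_(mu_t) is
    affine with fixed point V (mu_t). This makes the residual an average of
    its previous value and of the noise (P_(mu_t) - I) w_t. *)
Lemma bellman_residual_limsup delta : 0 < delta ->
  \forall t \near \oo, forall i,
    bellman_mu M (mu t) (J t) i ord0 - J t i ord0 <= delta.
Proof.
apply: (@drift0 (fun t i => bellman_mu M (mu t) (J t) i ord0 - J t i ord0)
  (fun t i => \sum_j p (mu t) i j * w t j ord0 - w t i ord0)) => [i|t i].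
  apply: eq_is_cvg_series (@noise_lincomb_cvg
    (fun m j => p m i j - (if j == i then 1 else 0))) => t; congr (_ * _).
  under eq_bigr do rewrite mulrBl.
  rewrite sumrB; congr (_ - _).
  rewrite (bigD1 i) //= eqxx mul1r big1 ?addr0 // => j /negbTE ->.
  by rewrite mul0r.
have -> : bellman_mu M (mu t.+1) (J t.+1) = bellman M a0 (J t.+1).
  exact: mu_greedy.
have := bellman_le (mu t) (J t.+1) i; rewrite !bellman_muE J_recE.
have -> : \sum_j p (mu t) i j * J t.+1 j ord0 =
   (1 - gamma t) * (\sum_j p (mu t) i j * J t j ord0)
   + gamma t * (\sum_j p (mu t) i j * V (mu t) j ord0)
   + gamma t * (\sum_j p (mu t) i j * w t j ord0).
  rewrite !mulr_sumr -!big_split /=; apply: eq_bigr => j _.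
  by rewrite J_recE; ring.
rewrite (VE (mu t) i); lra.
Qed.

Let K := \sum_m \sum_i xi m i ord0.

Let xi_le_K m i : xi m i ord0 <= K.
Proof.
rewrite /K (bigD1 m) //= (bigD1 i) //= -addrA lerDl addr_ge0 //.
  by apply: sumr_ge0.
by apply: sumr_ge0 => m' _; apply: sumr_ge0.
Qed.

Let K_ge0 : 0 <= K.
Proof. by apply: sumr_ge0 => m _; apply: sumr_ge0. Qed.

(** Eventually V (mu_t) <= T J_t + K e <= T_m J_t + K e, so J_t - V m follows
    the drift recursion for the matrix of m. *)
Lemma limsup_le_policy m eta : 0 < eta ->
  \forall t \near \oo, forall i, J t i ord0 - V m i ord0 <= eta.
Proof.
(* The drift lemma returns (K e + e) xi <= (K + 1)^2 e, which this choice of e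
   makes equal to eta. *)
move=> eta0; pose e := eta / (K + 1) ^+ 2.
have K1 : 0 < K + 1 by rewrite ltr_wpDl.
have e0 : 0 < e by rewrite divr_gt0 // exprn_gt0.
have Ke0 : 0 <= K * e by rewrite mulr_ge0 // ltW.
have wcvg i : cvgn (series (fun t => gamma t * w t i ord0)).
  apply: eq_is_cvg_series (@noise_coordinate_cvg 1 i) => t.
  by rewrite mul1r.
have := @drift_limsup R 'I_n (p m) (fun i => xi m i ord0) gamma
  (fun t i => J t i ord0 - V m i ord0) (fun t i => w t i ord0) (K * e)
  (p_ge0 m) (p_sum m) (xi_ge1 m) (p_xi m) gamma_ge0 gamma_cvg0 gamma_div Ke0
  wcvg _ e e0.
move=> H; have {}H := H _; apply: filterS (H _) => [t Ht i|].
  apply: le_trans (Ht i) _.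
  have -> : eta = (K * e + e) * (K + 1) by rewrite /e; field; lra.
  by rewrite ler_wpM2l ?addr_ge0 ?(ltW e0) // (le_trans (xi_le_K m i)) // lerDl.
apply: filterS (bellman_residual_limsup e0) => t Ht i.
rewrite J_recE.
have Vle : V (mu t) i ord0 <= bellman_mu M m (J t) i ord0 + K * e.
  apply: le_trans (residual_bound (ltW e0) Ht i) _; apply: lerD.
    have -> : bellman_mu M (mu t) (J t) = bellman M a0 (J t) by exact: mu_greedy.
    exact: bellman_le.
  by rewrite mulrC ler_wpM2r // ltW.
have : gamma t * V (mu t) i ord0 <=
    gamma t * (bellman_mu M m (J t) i ord0 + K * e) by rewrite ler_wpM2l.
under eq_bigr do rewrite mulrBr.
rewrite sumrB bellman_muE {2}(VE m i); have := VE m i.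
lra.
Qed.

Lemma liminf_ge_lower_bound (L : 'I_n -> R) :
  (forall m i, L i <= V m i ord0) ->
  forall eta, 0 < eta ->
  \forall t \near \oo, forall i, L i - J t i ord0 <= eta.
Proof.
move=> LV; apply: (@drift0 _ (fun t i => -1 * w t i ord0)) => [i|t i].
  exact: noise_coordinate_cvg.
rewrite J_recE.
have : gamma t * L i <= gamma t * V (mu t) i ord0 by rewrite ler_wpM2l.
lra.
Qed.

Theorem optimistic_iteration_cvg :
  J t @[t --> \oo] -->
  (\col_i min_over ([ffun=> a0] : policy n A) (fun m => V m i ord0) : 'cV[R]_n).
Proof.
set Jopt := (X in _ --> X).
have Jopt_le m i : Jopt i ord0 <= V m i ord0.
  by rewrite mxE; exact: (min_over_le _ (fun m => V m i ord0)).
have Jopt_ex i : exists m, Jopt i ord0 = V m i ord0.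
  by rewrite mxE; exact: min_over_attained.
apply/cvg_ballP => e e0.
have e20 : 0 < e / 2 by rewrite divr_gt0.
have lower := liminf_ge_lower_bound Jopt_le e20.
have upper : \forall t \near \oo, forall m i, J t i ord0 - V m i ord0 <= e / 2.
  by apply: filter_forall => m; exact: limsup_le_policy.
apply: filterS (filterI lower upper) => t [lo hi]; split=> // i j.
rewrite (ord1 j) /ball /=; have [m Jm] := Jopt_ex i.
have := lo i; have := hi m i; rewrite Jm ltr_norml => ? ?.
by apply/andP; split; lra.
Qed.

End pathwise.

(** * Summability of the noise *)

Lemma ler_mx_entry (R : realType) m n (B : 'M[R]_(m, n)) i j : `|B i j| <= `|B|.
Proof.
rewrite [leRHS]/Num.Def.normr /= mx_normrE.
exact: (le_bigmax _ (fun ij => `|B ij.1 ij.2|) (i, j)).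
Qed.

Section noise.
Context (R : realType) (n : nat) (A : finType).
Context (d : measure_display) (Omega : measurableType d).
Variables (P : probability Omega R).
Variables (V : policy n A -> 'cV[R]_n) (gamma : nat -> R).
Variables (J w : nat -> Omega -> 'cV[R]_n) (mu : nat -> Omega -> policy n A).
Hypothesis J_meas : forall t i, measurable_fun setT (fun om => J t om i ord0).
Hypothesis mu_meas : forall t m, measurable [set om | mu t om = m].
Hypothesis w_mean : forall t i, is_condexp P (natural_filtration J mu t)
  (fun om => w t om i ord0) (fun=> 0).
Variable C : R.
Hypothesis w_var : forall t, exists2 Y : Omega -> R,
  is_condexp P (natural_filtration J mu t) (fun om => `|w t om| ^+ 2) Y
  & {ae P, forall om, Y om <= C}.
Hypothesis J_rec : forall t om, J t.+1 om = (1 - gamma t) *: J t om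
  + gamma t *: (V (mu t om) + w t om).

(* The generators of [natural_filtration J mu t]. *)
Let G t : set (set Omega) := [set E | exists2 k, (k <= t)%N &
  (exists i, exists2 B : set R, measurable B &
     E = [set om | B (J k om i ord0)]) \/
  (exists m : policy n A, E = [set om | mu k om = m])].

Let G_measurable t : <<s G t >> `<=` measurable.
Proof.
apply: smallest_sub; first exact: sigma_algebra_measurable.
move=> _ [k _ [[i [B mB ->]]|[m ->]]]; last exact: mu_meas.
by rewrite -[X in measurable X]setTI; exact: J_meas.
Qed.

Let G_mono t u : (t <= u)%N -> <<s G t >> `<=` <<s G u >>.
Proof.
move=> tu; apply: sub_smallest2r; first exact: smallest_sigma_algebra.
by move=> E [k kt Ek]; exists k => //; exact: leq_trans tu.
Qed.

Let J_adapted t u i : (t <= u)%N -> adapted_to (G u) (fun om => J t om i ord0).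
Proof.
move=> tu; apply/adapted_toP => B mB; apply: sub_gen_smallest; exists t => //.
by left; exists i, B.
Qed.

Let mu_event t u m : (t <= u)%N -> <<s G u >> [set om | mu t om = m].
Proof.
by move=> tu; apply: sub_gen_smallest; exists t => //; right; exists m.
Qed.

Variables (m : policy n A) (j : 'I_n).
Let x t om : R := if mu t om == m then gamma t * w t om j ord0 else 0.

Let w_int t : P.-integrable setT (EFin \o (fun om => w t om j ord0)).
Proof. by case: (w_mean t j). Qed.

Let w_meas t : measurable_fun setT (fun om => w t om j ord0).
Proof. by case/integrableP : (w_int t) => /measurable_EFinP. Qed.

Let mu_eq_meas t : measurable_fun setT (fun om => mu t om == m).
Proof.
apply: (measurable_fun_bool true); rewrite setTI.
rewrite (_ : _ @^-1` _ = [set om | mu t om = m]); first exact: mu_meas.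
by apply/seteqP; split=> om /= /eqP.
Qed.

Let x_meas t : measurable_fun setT (x t).
Proof.
by apply: measurable_fun_ifT => //; exact: measurable_funM.
Qed.

Let w_square_int t : P.-integrable setT (fun om => (`|w t om| ^+ 2)%:E).
Proof. by have [Y [? _ _ _] _] := w_var t. Qed.

Let w_square_le t : (\int[P]_om (`|w t om| ^+ 2)%:E <= `|C|%:E)%E.
Proof.
have [Y [_ Yint _ Yeq] YC] := w_var t.
rewrite (Yeq setT); last exact: (@measurableT _ (g_sigma_algebraType (G t))).
have mY : measurable_fun setT Y by case/integrableP : Yint => /measurable_EFinP.
apply: (@le_trans _ _ (\int[P]_om (Num.max (Y om) 0)%:E)%E).
  apply: le_integral => //.
    rewrite (_ : (fun om => _) = EFin \o Y^\+) //; exact: integrable_funrpos.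
  by move=> om _; rewrite lee_fin le_max lexx.
have -> : `|C|%:E = (\int[P]_om (cst `|C|%:E) om)%E.
  by rewrite integral_cst // [X in (_ * X)%E]probability_setT mule1.
apply: ae_ge0_le_integral => //.
- by move=> om _; rewrite lee_fin le_max lexx orbT.
- by apply/measurable_EFinP; exact: measurable_maxr.
- by move=> om _; rewrite lee_fin.
- move: YC; apply: filterS => om Yle _; rewrite lee_fin ge_max normr_ge0 andbT.
  exact: le_trans (ler_norm C).
Qed.

(** The increment is known at time t + 1 because the recursion expresses
    gamma_t w_t through J_(t+1), J_t and V m, the last one being constant on
    the event mu_t = m. Its mean over E is that of gamma_t w_t over the event
    E and mu_t = m, both known at time t. *)
Lemma noise_martingale_differences :
  square_martingale_differences P G x (fun t => gamma t ^+ 2 * `|C|).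
Proof.
have x_le t om : x t om ^+ 2 <= gamma t ^+ 2 * `|w t om| ^+ 2.
  rewrite /x; case: ifP => _; last by rewrite expr0n mulr_ge0 // sqr_ge0.
  rewrite exprMn ler_wpM2l ?sqr_ge0 // -(real_normK (num_real (w _ _ _ _))).
  by rewrite ler_pXn2r ?nnegrE //; exact: ler_mx_entry.
have x2_meas t : measurable_fun setT (fun om => (x t om ^+ 2)%:E).
  by apply/measurable_EFinP; exact: measurable_funX.
have gw2_int t : P.-integrable setT
    (fun om => (gamma t ^+ 2)%:E * (`|w t om| ^+ 2)%:E)%E.
  exact: integrableZl.
split=> t.
- exact: G_measurable.
- exact: G_mono.
- rewrite (_ : x t = fun om => if mu t om == m then
     J t.+1 om j ord0 - (1 - gamma t) * J t om j ord0 - gamma t * V m j ord0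
     else 0); last first.
    apply/funext => om; rewrite /x; case: eqP => [<-|//].
    by rewrite J_rec !mxE; ring.
  apply: measurable_fun_ifT; last exact: measurable_cst.
    apply: (measurable_fun_bool true); rewrite setTI.
    rewrite (_ : _ @^-1` _ = [set om | mu t om = m]); first exact: mu_event.
    by apply/seteqP; split=> om /= /eqP.
  apply: measurable_funB; last exact: measurable_cst.
  apply: measurable_funB; first exact: J_adapted.
  apply: measurable_funM; first exact: measurable_cst.
  exact: J_adapted.
- move=> E GE; pose F := E `&` [set om | mu t om = m].
  have GF : <<s G t >> F.
    by apply: (@measurableI _ (g_sigma_algebraType (G t))) => //; exact: mu_event.
  have mF : measurable F := G_measurable GF.
  transitivity ((gamma t)%:E * \int[P]_(om in F) (w t om j ord0)%:E)%E.
    rewrite -integralZl //; last exact: integrableS (w_int t).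
    rewrite [LHS]integral_mkcond [RHS]integral_mkcond.
    apply: eq_integral => om _; rewrite !patchE /F in_setI /x; case: (om \in E) => //=.
    have [mE|mE] := eqVneq (mu t om) m; first by rewrite mem_set //= EFinM.
    by rewrite memNset //=; apply/eqP.
  have [_ _ _ wE] := w_mean t j.
  by rewrite wE // integral0_eq // mule0.
- apply: (le_integrable measurableT _ _ (gw2_int t)) => // om _.
  rewrite -EFinM /= lee_fin !ger0_norm ?sqr_ge0 //.
  by rewrite mulr_ge0 // sqr_ge0.
- apply: (@le_trans _ _
    (\int[P]_om ((gamma t ^+ 2)%:E * (`|w t om| ^+ 2)%:E))%E).
    apply: ge0_le_integral => //.
    + by move=> om _; rewrite lee_fin sqr_ge0.
    + exact: measurable_int (gw2_int t).
    + by move=> om _; rewrite -EFinM lee_fin.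
  rewrite integralZl // [leRHS]EFinM; apply: lee_wpmul2l => //.
  by rewrite lee_fin sqr_ge0.
Qed.

Lemma noise_series_cvg :
  cvgn (series (fun t => gamma t ^+ 2)) ->
  {ae P, forall om, cvgn (series (fun t =>
     if mu t om == m then gamma t * w t om j ord0 else 0))}.
Proof.
move=> g2; apply: (martingale_series_cvg noise_martingale_differences).
  by move=> t; rewrite mulr_ge0 // sqr_ge0.
rewrite (_ : (fun t => _) = `|C| *: (fun t => gamma t ^+ 2)).
  exact: is_cvg_seriesZ.
by apply/funext => t; rewrite mulrC.
Qed.

End noise.

(** * Almost sure convergence *)

Lemma nneseries_pinfty_cvg (R : realType) (u : nat -> R) :
  (forall t, 0 <= u t) -> (\sum_(0 <= t <oo) (u t)%:E = +oo)%E ->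
  series u @ \oo --> +oo.
Proof.
move=> u0 usum; apply/cvgeryP; rewrite -usum.
rewrite (_ : (fun t => _) = fun t => (\sum_(0 <= k < t) (u k)%:E)%E).
  by apply: is_cvg_nneseries => t _ _; rewrite lee_fin.
by apply/funext => t; rewrite sumEFin.
Qed.

Lemma sqr_series_cvg0 (R : realType) (u : nat -> R) :
  cvgn (series (fun t => u t ^+ 2)) -> u @ \oo --> 0.
Proof.
move=> /cvg_series_cvg_0 u20; apply/cvgr0Pnorm_lt => e e0.
have /cvgr0_norm_lt/(_ _ (exprn_gt0 2 e0)) := u20.
apply: filterS => t; rewrite normrX ltr_pXn2r ?nnegrE //; exact: ltW.
Qed.

Theorem theorem10 (R : realType) (n : nat) (A : finType) (a0 : A)
    (M : ssp R n A)
    (dT : measure_display) (Tr : measurableType dT)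
    (Q : policy n A -> 'I_n -> probability Tr R)
    (s : nat -> Tr -> option 'I_n)
    (s_chain : forall m i, markov_chain M (Q m i) s m i)
    (all_proper : forall m, proper_policy Q s m)
    (gamma : nat -> R)
    (gamma_ge0 : forall t, 0 <= gamma t)
    (gamma_sum : (\sum_(0 <= t <oo) (gamma t)%:E = +oo)%E)
    (gamma_sqsum : (\sum_(0 <= t <oo) (gamma t ^+ 2)%:E < +oo)%E)
    (d : measure_display) (Omega : measurableType d) (P : probability Omega R)
    (J w : nat -> Omega -> 'cV[R]_n) (mu : nat -> Omega -> policy n A)
    (J_meas : forall t i, measurable_fun setT (fun om => J t om i ord0))
    (mu_meas : forall t m, measurable [set om | mu t om = m])
    (w_mean : forall t i, is_condexp P (natural_filtration J mu t)
       (fun om => w t om i ord0) (fun=> 0))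
    (C : R)
    (w_var : forall t, exists2 Y : Omega -> R,
       is_condexp P (natural_filtration J mu t) (fun om => `|w t om| ^+ 2) Y
       & {ae P, forall om, Y om <= C})
    (mu_greedy : forall t om, greedy M a0 (mu t om) (J t om))
    (J_rec : forall t om, J t.+1 om =
       (1 - gamma t) *: J t om
       + gamma t *: (cost_to_go M Q s (mu t om) + w t om)) :
  {ae P, forall om, J t om @[t --> \oo] --> opt_cost M Q s a0}.
Proof.
pose V := cost_to_go M Q s.
pose xi m : 'cV[R]_n := potential (P_of M m) *m const_mx 1.
have transient m i j : (P_of M m ^+ t) i j @[t --> \oo] --> 0.
  exact: (marginal_cvg0 (s_chain m i) j (all_proper m i)).
have VE m : V m = potential (P_of M m) *m g_of M m.
  apply/colP => i; rewrite mxE.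
  by rewrite (expected_total_cost (s_chain m i) (transient m)).
have V_bellman m : V m = bellman_mu M m (V m).
  by rewrite VE /bellman_mu -(potentialE (transient m)).
have xi_time m : xi m = const_mx 1 + P_of M m *m xi m.
  exact: (potentialE (transient m)).
have xi_ge0 m i : 0 <= xi m i ord0.
  have cv := @series_pow_cvg _ _ _ (transient m) (const_mx 1) i.
  rewrite -(cvg_lim (@Rhausdorff R) cv); apply: limr_ge; first exact: cvgP cv.
  apply: nearW => T; apply: sumr_ge0 => t _.
  rewrite mxE; apply: sumr_ge0 => j _; rewrite mxE mulr1 -lee_fin.
  by rewrite -(chain_marginal (s_chain m i)) measure_ge0.
have sq_cvg : cvgn (series (fun t => gamma t ^+ 2)).
  by apply: nnseries_is_cvg => // t; exact: sqr_ge0.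
have noise : {ae P, forall om, forall m j, cvgn (series (fun t =>
    if mu t om == m then gamma t * w t om j ord0 else 0))}.
  apply: filter_forall => m; apply: filter_forall => j.
  exact: (noise_series_cvg J_meas mu_meas w_mean w_var J_rec).
move: noise; apply: filterS => om noise_om.
exact: (optimistic_iteration_cvg V_bellman xi_ge0 xi_time gamma_ge0
  (sqr_series_cvg0 sq_cvg) (nneseries_pinfty_cvg gamma_ge0 gamma_sum)
  noise_om (fun t => mu_greedy t om) (fun t => J_rec t om)).
Qed.
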